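(* Let $q \ge 2$ be an integer, let $(\varepsilon_d : d \in \mathcal{D}_q)$ be a probability vector indexed by the set $\mathcal{D}_q$ of positive divisors of $q$, and let $V = V_{(q)}(\varepsilon_d : d \in \mathcal{D}_q)$ be the associated generalized erasure channel. Let $\gamma \in \mathbb{Z}_q^{\times} = \{ z \in \mathbb{Z}_q \mid \gcd(z,q) = 1\}$, and let $V^0$ and $V^1$ be the two channels obtained from $V$ by the one-step polar transformation with parameter $\gamma$. Then $V^0$ is equivalent to $V_{(q)}(\varepsilon_d^- : d \in \mathcal{D}_q)$ and $V^1$ is equivalent to $V_{(q)}(\varepsilon_d^+ : d \in \mathcal{D}_q)$, where for each $d \in \mathcal{D}_q$ $$\varepsilon_d^- = \sum_{\substack{d_1, d_2 \in \mathcal{D}_q : \\ \gcd(d_1,d_2) = d}} \varepsilon_{d_1} \varepsilon_{d_2}, \qquad \varepsilon_d^+ = \sum_{\substack{d_1, d_2 \in \mathcal{D}_q : \\ \mathrm{lcm}(d_1,d_2) = d}} \varepsilon_{d_1} \varepsilon_{d_2}$$ (sums over ordered pairs $(d_1,d_2)$).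
   Context: **Channels.** $\mathbb{Z}_q = \{0,1,\dots,q-1\}$. A ($q$-ary input, discrete memoryless) channel $W : \mathbb{Z}_q \to \mathcal{Y}$ with finite output alphabet $\mathcal{Y}$ is a family of conditional probabilities $W(y \mid x)$, $(x,y) \in \mathbb{Z}_q \times \mathcal{Y}$, with $W(\cdot \mid x)$ a probability distribution on $\mathcal{Y}$ for each $x$. **Symmetric capacity of order $\alpha$.** For $\alpha \in (0,1)\cup(1,\infty)$, $$I_\alpha(W) = \frac{\alpha}{\alpha-1} \ln \Bigg[ \sum_{y \in \mathcal{Y}} \Big( \sum_{x \in \mathbb{Z}_q} \tfrac{1}{q} W(y \mid x)^\alpha \Big)^{1/\alpha} \Bigg],$$ and for $\alpha\in\{0,1,\infty\}$ it is defined by limits: $I_0(W) = \lim_{\alpha\to 0^+} I_\alpha(W) = \min_{y} \ln \frac{q}{|\{x \in \mathbb{Z}_q : W(y\mid x) > 0\}|}$ (outputs $y$ with $W(y\mid x)=0$ for all $x$ are ignored), $I_1(W) = \lim_{\alpha \to 1} I_\alpha(W) = \sum_{y}\sum_{x} \frac1q W(y\mid x) \ln \frac{W(y\mid x)}{\sum_{x'} \frac1q W(y \mid x')}$, $I_\infty(W) = \lim_{\alpha\to\infty} I_\alpha(W) = \ln \sum_{y} \max_{x} W(y\mid x)$. **Polar transformation.** Fix $\gamma \in \mathbb{Z}_q^\times$ and put $f_\gamma(u_1,u_2) = u_1 + \gamma u_2 \bmod q \in \mathbb{Z}_q$. The one-step polar transformation with parameter $\gamma$ maps $W : \mathbb{Z}_q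 \to \mathcal{Y}$ to the channels $W^0 : \mathbb{Z}_q \to \mathcal{Y}^2$ and $W^1 : \mathbb{Z}_q \to \mathcal{Y}^2 \times \mathbb{Z}_q$, $$W^0(y_1,y_2 \mid u_1) = \sum_{u_2 \in \mathbb{Z}_q} \tfrac1q W(y_1 \mid f_\gamma(u_1,u_2)) W(y_2 \mid u_2),$$ $$W^1(y_1,y_2,u_1 \mid u_2) = \tfrac1q W(y_1 \mid f_\gamma(u_1,u_2)) W(y_2 \mid u_2).$$ For $n \ge 0$ and $0 \le i \le 2^n - 1$ with binary representation $(b_1,\dots,b_n)$ ($b_1$ the most significant bit), $W_{2^n}^{(i)} = (\cdots((W^{b_1})^{b_2})\cdots)^{b_n}$ (all steps with the same $\gamma$); for $n=0$ this is $W$ itself. **Equivalence.** Two $q$-ary input channels $W$ and $W'$ are equivalent if $I_\alpha(W_{2^n}^{(i)}) = I_\alpha((W')_{2^n}^{(i)})$ for all integers $n \ge 0$, all $i \in \{0,\dots,2^n-1\}$ and all $\alpha \in [0,\infty]$. **Generalized erasure channel.** $\mathcal{D}_q$ is the set of positive divisors of $q$. For $d \in \mathbb{N}$ and $r \in \mathbb{Z}$, $[r]_d = \{ z \in \mathbb{Z} : z \equiv r \pmod d\}$ and $\mathbb{Z}/d\mathbb{Z} = \{[r]_d : r \in \mathbb{Z}\}$. Given $\varepsilon_d \ge 0$ ($d\in\mathcal{D}_q$) with $\sum_{d \in \mathcal{D}_q} \varepsilon_d = 1$, the channel $V_{(q)}(\varepsilon_d : d \in \mathcal{D}_q)$ has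 input alphabet $\mathbb{Z}_q$, output alphabet $\mathcal{Y} = \bigcup_{d \in \mathcal{D}_q} (\mathbb{Z}/d\mathbb{Z})$ (a disjoint union), and transition probabilities $V(y \mid x) = \varepsilon_d$ if $y = [x]_d$ for some $d \in \mathcal{D}_q$, and $V(y\mid x) = 0$ otherwise. *)

(* Defs.v *)
From HB Require Import structures.
From mathcomp Require Import all_boot all_order all_algebra.
From mathcomp Require Import all_classical all_reals all_analysis.

Set Implicit Arguments.
Unset Strict Implicit.
Unset Printing Implicit Defensive.

Import Order.TTheory GRing.Theory Num.Theory.
Import numFieldNormedType.Exports.

Local Open Scope classical_set_scope.
Local Open Scope ring_scope.

Record fdist (R : realType) (T : finType) := Fdist {
  fdist_fun :> T -> R ;
  fdist_ge0 : forall t, 0 <= fdist_fun t ;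
  fdist_sum1 : \sum_t fdist_fun t = 1 }.

(* The output alphabet is bundled with the channel, because it changes at each
   step of the polar transformation. [W x y] stands for W(y | x). *)
Record channel (R : realType) (q : nat) := Channel {
  output : finType ;
  trans :> 'Z_q -> fdist R output }.

Section PolarTransformation.
Variables (R : realType) (q : nat).

Definition fgamma (gamma u1 u2 : 'Z_q) : 'Z_q := u1 + gamma * u2.

Definition minus_prob (gamma : 'Z_q) (W : channel R q) (u1 : 'Z_q)
    (y : output W * output W) : R :=
  \sum_(u2 : 'Z_q) q%:R^-1 * W (fgamma gamma u1 u2) y.1 * W u2 y.2.

Definition plus_prob (gamma : 'Z_q) (W : channel R q) (u2 : 'Z_q)
    (y : output W * output W * 'Z_q) : R :=
  q%:R^-1 * W (fgamma gamma y.2 u2) y.1.1 * W u2 y.1.2.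

Lemma minus_prob_ge0 gamma W u1 y : 0 <= @minus_prob gamma W u1 y.
Proof.
by apply: sumr_ge0 => u2 _; rewrite !mulr_ge0 ?invr_ge0 ?fdist_ge0.
Qed.

Lemma plus_prob_ge0 gamma W u2 y : 0 <= @plus_prob gamma W u2 y.
Proof. by rewrite !mulr_ge0 ?invr_ge0 ?fdist_ge0. Qed.

Lemma fdist_prod_sum1 (T : finType) (P Q : fdist R T) (c : R) :
  \sum_(y : T * T) c * P y.1 * Q y.2 = c.
Proof.
rewrite -(pair_bigA _ (fun a b => c * P a * Q b)) /=.
under eq_bigr => a _ do rewrite -mulr_sumr fdist_sum1 mulr1.
by rewrite -mulr_sumr fdist_sum1 mulr1.
Qed.

Lemma sum_uniform (hq : (1 < q)%N) : \sum_(u : 'Z_q) q%:R^-1 = 1 :> R.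
Proof.
rewrite sumr_const card_ord Zp_cast // -[_ *+ _]mulr_natl mulfV //.
by rewrite pnatr_eq0 -lt0n ltnW.
Qed.

Lemma minus_prob_sum1 (hq : (1 < q)%N) gamma W u1 :
  \sum_y @minus_prob gamma W u1 y = 1.
Proof.
rewrite /minus_prob exchange_big -[RHS](sum_uniform hq).
by apply: eq_bigr => u2 _; rewrite -[RHS](fdist_prod_sum1 (W (fgamma gamma u1 u2)) (W u2)).
Qed.

Lemma plus_prob_sum1 (hq : (1 < q)%N) gamma W u2 :
  \sum_y @plus_prob gamma W u2 y = 1.
Proof.
rewrite -(pair_bigA _ (fun a b => @plus_prob gamma W u2 (a, b))) exchange_big.
rewrite -[RHS](sum_uniform hq).
by apply: eq_bigr => u1 _; rewrite -[RHS](fdist_prod_sum1 (W (fgamma gamma u1 u2)) (W u2)).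
Qed.

Definition polar_minus (hq : (1 < q)%N) (gamma : 'Z_q) (W : channel R q) :
    channel R q :=
  Channel (fun u1 => Fdist (@minus_prob_ge0 gamma W u1)
                           (minus_prob_sum1 hq gamma W u1)).

Definition polar_plus (hq : (1 < q)%N) (gamma : 'Z_q) (W : channel R q) :
    channel R q :=
  Channel (fun u2 => Fdist (@plus_prob_ge0 gamma W u2)
                           (plus_prob_sum1 hq gamma W u2)).

Definition polar (hq : (1 < q)%N) (gamma : 'Z_q) (W : channel R q) (b : bool) :
    channel R q :=
  if b then polar_plus hq gamma W else polar_minus hq gamma W.

(* The binary digits b_1, ..., b_n of i, most significant first. *)
Definition bits (n i : nat) : seq bool :=
  [seq odd (i %/ 2 ^ (n - j)) | j <- iota 1 n].

Definition synthetic (hq : (1 < q)%N) (gamma : 'Z_q) (W : channel R q)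
    (n i : nat) : channel R q :=
  foldl (polar hq gamma) W (bits n i).

End PolarTransformation.

Section Capacity.
Variables (R : realType) (q : nat).

Definition renyi_capacity (W : channel R q) (a : R) : R :=
  a / (a - 1) *
  ln (\sum_(y : output W) (\sum_(x : 'Z_q) q%:R^-1 * W x y `^ a) `^ a^-1).

(* Orders 0, 1 and +oo are defined by limits; -oo is not an order, and the
   value there is a dummy. *)
Definition capacity (W : channel R q) (alpha : \bar R) : R :=
  match alpha with
  | a%:E => if a == 0 then lim (renyi_capacity W b @[b --> (0 : R)^'+])
            else if a == 1 then lim (renyi_capacity W b @[b --> (1 : R)^'])
            else renyi_capacity W a
  | +oo%E => lim (renyi_capacity W b @[b --> +oo])
  | -oo%E => 0
  end.

Definition equivalent (hq : (1 < q)%N) (gamma : 'Z_q) (W W' : channel R q) :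
    Prop :=
  forall (n i : nat) (alpha : \bar R), (i < 2 ^ n)%N -> (0 <= alpha)%E ->
    capacity (synthetic hq gamma W n i) alpha =
    capacity (synthetic hq gamma W' n i) alpha.

End Capacity.

Definition Dq (q : nat) : finType := seq_sub (divisors q).

Section Erasure.
Variables (R : realType) (q : nat).

(* The disjoint union of the Z/dZ for d in D_q; the class [r]_d is encoded as
   the pair of d and the representative of r in {0, ..., d - 1}. ['Z_d] would be
   wrong here, since ['Z_1] has two elements. *)
Definition residues : finType := {d : Dq q & 'I_(val d)}.

Definition erasure_prob (eps : fdist R (Dq q)) (x : 'Z_q) (y : residues) : R :=
  if (tagged y : nat) == (x %% val (tag y))%N then eps (tag y) else 0.

Lemma erasure_prob_ge0 eps x y : 0 <= erasure_prob eps x y.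
Proof. by rewrite /erasure_prob; case: ifP => // _; exact: fdist_ge0. Qed.

Lemma Dq_gt0 (d : Dq q) : (0 < val d)%N.
Proof.
case: d => d /= hd; case: (posnP q) hd => [->|q0]; first by rewrite inE => /eqP->.
by rewrite -dvdn_divisors // => /dvdn_gt0; exact.
Qed.

Lemma erasure_prob_sum1 eps x : \sum_y erasure_prob eps x y = 1.
Proof.
transitivity (\sum_(d : Dq q) \sum_(r : 'I_(val d))
    erasure_prob eps x (Tagged (fun d : Dq q => 'I_(val d)) r)).
  by rewrite sig_big_dep; apply: eq_bigr => -[].
rewrite -(fdist_sum1 eps).
apply: eq_bigr => d _.
rewrite (bigD1 (Ordinal (ltn_pmod x (Dq_gt0 d)))) //= /erasure_prob /= eqxx.
by rewrite big1 ?addr0 // => r; rewrite -val_eqE /= => /negbTE ->.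
Qed.

Definition erasure_channel (eps : fdist R (Dq q)) : channel R q :=
  Channel (fun x => Fdist (erasure_prob_ge0 eps x) (erasure_prob_sum1 eps x)).

Definition eps_comb (op : nat -> nat -> nat) (eps : fdist R (Dq q)) (d : Dq q) :
    R :=
  \sum_(p : Dq q * Dq q | op (val p.1) (val p.2) == val d) eps p.1 * eps p.2.

Lemma eps_comb_ge0 op eps d : 0 <= eps_comb op eps d.
Proof. by apply: sumr_ge0 => p _; rewrite mulr_ge0 ?fdist_ge0. Qed.

Lemma eps_comb_sum1 op eps :
  (forall d1 d2 : Dq q, op (val d1) (val d2) \in divisors q) ->
  \sum_d eps_comb op eps d = 1.
Proof.
move=> hop; rewrite -[RHS](fdist_prod_sum1 eps eps).
under [RHS]eq_bigr => p _ do rewrite mul1r.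
rewrite [RHS](partition_big (fun p => SeqSub (hop p.1 p.2)) xpredT) //.
Qed.

Lemma gcdn_Dq (d1 d2 : Dq q) : gcdn (val d1) (val d2) \in divisors q.
Proof.
case: d1 d2 => [d1 h1] [d2 h2] /=; case: (posnP q) h1 h2 => [->|q0].
  by rewrite !inE => /eqP-> /eqP->.
rewrite -!dvdn_divisors // => h1 _; exact: dvdn_trans (dvdn_gcdl _ _) h1.
Qed.

Lemma lcmn_Dq (d1 d2 : Dq q) : lcmn (val d1) (val d2) \in divisors q.
Proof.
case: d1 d2 => [d1 h1] [d2 h2] /=; case: (posnP q) h1 h2 => [->|q0].
  by rewrite !inE => /eqP-> /eqP->.
by rewrite -!dvdn_divisors // dvdn_lcm => -> ->.
Qed.

Definition eps_minus (eps : fdist R (Dq q)) : fdist R (Dq q) :=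
  Fdist (eps_comb_ge0 gcdn eps) (eps_comb_sum1 eps gcdn_Dq).

Definition eps_plus (eps : fdist R (Dq q)) : fdist R (Dq q) :=
  Fdist (eps_comb_ge0 lcmn eps) (eps_comb_sum1 eps lcmn_Dq).

End Erasure.

(* Main.v *)
Require Import Defs.
From HB Require Import structures.
From mathcomp Require Import all_boot all_order all_algebra.
From mathcomp Require Import all_classical all_reals all_analysis.
From mathcomp Require Import ring.

(** Two channels whose outputs have the same multiset of likelihood vectors, up
    to merging or splitting proportional vectors, agree on every functional
    [W |-> sum_y f (W(y | .))] with [f] positively homogeneous of degree 1. This
    relation is stable under both polar transformations (fixing one of the two
    output symbols leaves a homogeneous functional of the other), and it
    determines every [I_alpha], since the inner expression
    [v |-> (sum_x v_x^alpha / q)^(1/alpha)] is homogeneous. It remains to compare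
    such functionals on [V^0], [V^1] and the erasure channels: the likelihood
    vector of [V^0] at classes mod [d1] and [d2] is [eps_d1 eps_d2 / lcm(d1, d2)]
    times the indicator of a class mod [gcd(d1, d2)], and that of [V^1] is either
    zero or [eps_d1 eps_d2 / q] times the indicator of a class mod
    [lcm(d1, d2)]. *)

Set Implicit Arguments.
Unset Strict Implicit.
Unset Printing Implicit Defensive.

Import Order.TTheory GRing.Theory Num.Theory.

Local Open Scope ring_scope.

(** * Homogeneous functionals of likelihood vectors and their behaviour under polarization *)

Section OutputProfiles.
Variables (R : realType) (q : nat).
Implicit Types (W : channel R q) (f : ('Z_q -> R) -> R).

(** The case [c = 0] forces [f] to vanish at the zero vector, so impossible outputs contribute
    nothing. *)
Definition homogeneous f :=
  forall (c : R) v, 0 <= c -> f (fun x => c * v x) = c * f v.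

Definition profile f W : R := \sum_(y : output W) f (fun x => W x y).

Definition same_profile W W' :=
  forall f, homogeneous f -> profile f W = profile f W'.

Lemma homogeneous0 f : homogeneous f -> f (fun=> 0) = 0.
Proof.
move=> hf; rewrite -[RHS](mul0r (f (fun=> 0))) -hf //; congr f.
by apply/funext => x; rewrite mul0r.
Qed.

Lemma profile_minus (hq : (1 < q)%N) gamma f W :
  profile f (polar_minus hq gamma W) =
  profile (fun v => profile (fun w => f (fun x =>
    \sum_u q%:R^-1 * v (fgamma gamma x u) * w u)) W) W.
Proof. by rewrite /profile pair_bigA. Qed.

Lemma profile_plus (hq : (1 < q)%N) gamma f W :
  profile f (polar_plus hq gamma W) =
  profile (fun v => profile (fun w => \sum_u1 f (fun x =>
    q%:R^-1 * v (fgamma gamma u1 x) * w x)) W) W.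
Proof. by rewrite /profile !pair_bigA. Qed.

Lemma eq_profile f g W : f =1 g -> profile f W = profile g W.
Proof. by move=> fg; apply: eq_bigr => y _. Qed.

Lemma homogeneous_comp f (g : ('Z_q -> R) -> 'Z_q -> R) :
  (forall c v x, g (fun t => c * v t) x = c * g v x) ->
  homogeneous f -> homogeneous (f \o g).
Proof.
move=> hg hf c v c0 /=; rewrite -hf //; congr f.
exact/funext.
Qed.

Lemma homogeneous_sum (I : finType) (f : I -> ('Z_q -> R) -> R) :
  (forall i, homogeneous (f i)) -> homogeneous (fun v => \sum_i f i v).
Proof.
move=> hf c v c0; rewrite mulr_sumr; apply: eq_bigr => i _; exact: hf.
Qed.

Section Kernels.
Variables (f : ('Z_q -> R) -> R) (gamma : 'Z_q).
Hypothesis hf : homogeneous f.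

Lemma homogeneous_minusl w : homogeneous (fun v => f (fun x =>
  \sum_u q%:R^-1 * v (fgamma gamma x u) * w u)).
Proof.
apply: (homogeneous_comp _ hf) => c v x; rewrite mulr_sumr.
by apply: eq_bigr => u _; ring.
Qed.

Lemma homogeneous_minusr v : homogeneous (fun w => f (fun x =>
  \sum_u q%:R^-1 * v (fgamma gamma x u) * w u)).
Proof.
apply: (homogeneous_comp _ hf) => c w x; rewrite mulr_sumr.
by apply: eq_bigr => u _; ring.
Qed.

Lemma homogeneous_plusl w : homogeneous (fun v => \sum_u f (fun x =>
  q%:R^-1 * v (fgamma gamma u x) * w x)).
Proof.
by apply: homogeneous_sum => u; apply: (homogeneous_comp _ hf) => c v x; ring.
Qed.

Lemma homogeneous_plusr v : homogeneous (fun w => \sum_u f (fun x =>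
  q%:R^-1 * v (fgamma gamma u x) * w x)).
Proof.
by apply: homogeneous_sum => u; apply: (homogeneous_comp _ hf) => c w x; ring.
Qed.

End Kernels.

(** The kernel is homogeneous in each likelihood vector separately, so [W] is replaced by [W'] first
    in the inner profile, then in the outer one. *)
Lemma same_profile_polar (hq : (1 < q)%N) gamma W W' b :
  same_profile W W' ->
  same_profile (polar hq gamma W b) (polar hq gamma W' b).
Proof.
move=> WW' f hf; case: b => /=.
- rewrite !profile_plus (eq_profile _ (fun v => WW' _ (homogeneous_plusr gamma hf v))).
  by apply: WW'; apply: homogeneous_sum => y; apply: homogeneous_plusl.
- rewrite !profile_minus (eq_profile _ (fun v => WW' _ (homogeneous_minusr gamma hf v))).
  by apply: WW'; apply: homogeneous_sum => y; apply: homogeneous_minusl.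
Qed.

Lemma same_profile_synthetic (hq : (1 < q)%N) gamma W W' n i :
  same_profile W W' ->
  same_profile (synthetic hq gamma W n i) (synthetic hq gamma W' n i).
Proof.
rewrite /synthetic; elim: (bits n i) W W' => //= b s IH W W' WW'.
exact/IH/same_profile_polar.
Qed.

(* [homogeneous] quantifies over signed vectors, hence the absolute value. *)
Lemma homogeneous_renyi (a : R) : a != 0 -> homogeneous (fun v =>
  (\sum_x q%:R^-1 * `|v x| `^ a) `^ a^-1).
Proof.
move=> a0 c v c0.
set S := \sum_x _ * `|v x| `^ a.
rewrite (_ : \sum_x _ = c `^ a * S); last first.
  rewrite mulr_sumr; apply: eq_bigr => x _.
  by rewrite normrM (ger0_norm c0) powRM // mulrCA.
rewrite powRM ?powR_ge0 ?sumr_ge0 //.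
by rewrite -powRrM mulfV // powRr1.
Qed.

Lemma same_profile_capacity W W' : same_profile W W' -> capacity W = capacity W'.
Proof.
move=> WW'.
(* Equality as functions of the order makes the limits at 0, 1 and infinity coincide too. *)
have eqr : renyi_capacity W = renyi_capacity W'.
  apply/funext => a; rewrite /renyi_capacity.
  (* At order 0 the prefactor [a / (a - 1)] vanishes. *)
  have [->|a0] := eqVneq a 0; first by rewrite !mul0r.
  congr (_ * ln _); have := WW' _ (homogeneous_renyi a0).
  have normE (U : channel R q) :
      profile (fun v => (\sum_x q%:R^-1 * `|v x| `^ a) `^ a^-1) U =
      \sum_y (\sum_x q%:R^-1 * U x y `^ a) `^ a^-1.
    apply: eq_bigr => y _; congr (_ `^ _); apply: eq_bigr => x _.
    by rewrite ger0_norm ?fdist_ge0.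
  by rewrite !normE.
by apply/funext => -[a| |] //=; rewrite eqr.
Qed.

Lemma same_profile_equivalent (hq : (1 < q)%N) gamma W W' :
  same_profile W W' -> equivalent hq gamma W W'.
Proof.
move=> WW' n i alpha _ _.
by rewrite (same_profile_capacity (same_profile_synthetic hq gamma n i WW')).
Qed.

End OutputProfiles.

(** * Congruence classes in ['Z_q] modulo divisors of [q] *)

Section Congruences.
Variables (R : realType) (q : nat).
Hypothesis q_gt1 : (1 < q)%N.

Definition congr_class (d : nat) (s x : 'Z_q) : R := (d %| (x - s)%R)%N%:R.

Lemma dvdn_Zp_mod d m : (d %| q)%N -> (d %| (m%:R : 'Z_q))%N = (d %| m)%N.
Proof. by move=> dq; rewrite val_Zp_nat // /dvdn modn_dvdm. Qed.

(** Divisibility of the representative becomes membership in the ideal generated by [d], so ring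
    identities replace arithmetic on representatives. *)
Lemma dvdn_ZpP d (z : 'Z_q) :
  (d %| q)%N -> reflect (exists c : 'Z_q, z = c * d%:R) (d %| z)%N.
Proof.
move=> dq; apply: (iffP idP) => [/dvdnP[k e]|[c ->]].
  by exists k%:R; rewrite -natrM -e natr_Zp.
by rewrite -[c]natr_Zp -natrM dvdn_Zp_mod // dvdn_mull.
Qed.

Lemma dvdn_ZpD d (x y : 'Z_q) : (d %| q)%N ->
  (d %| x)%N -> (d %| (x + y)%R)%N = (d %| y)%N.
Proof.
move=> dq dx; rewrite -[x]natr_Zp -[y in LHS]natr_Zp -natrD dvdn_Zp_mod //.
by rewrite dvdn_addr.
Qed.

Lemma dvdn_ZpN d (x : 'Z_q) : (d %| q)%N -> (d %| (- x)%R)%N = (d %| x)%N.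
Proof.
move=> dq; apply/(dvdn_ZpP _ dq)/(dvdn_ZpP _ dq) => -[c e]; exists (- c).
  by rewrite mulNr -e opprK.
by rewrite mulNr e.
Qed.

Lemma dvdn_ZpMl d (g x : 'Z_q) : (d %| q)%N -> g \is a GRing.unit ->
  (d %| (g * x)%R)%N = (d %| x)%N.
Proof.
move=> dq gu; apply/(dvdn_ZpP _ dq)/(dvdn_ZpP _ dq) => -[c e].
  by exists (g^-1 * c); rewrite -mulrA -e mulKr.
by exists (g * c); rewrite e mulrA.
Qed.

Lemma congr_class_sym d s x : (d %| q)%N -> congr_class d s x = congr_class d x s.
Proof. by move=> dq; rewrite /congr_class -(dvdn_ZpN (x - s)) // opprB. Qed.

Lemma congr_class_modn d s x : (d %| q)%N ->
  congr_class d s x = (s %% d == x %% d)%N%:R.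
Proof.
move=> dq; rewrite /congr_class -{2}(subrK s x) /= modn_dvdm; last by rewrite Zp_cast.
by rewrite -{2}[val s]add0n eqn_modDr mod0n eq_sym.
Qed.

Lemma sum_dvdn_Zp d : (d %| q)%N ->
  \sum_(z : 'Z_q) (d %| z)%N%:R = q%:R / d%:R :> R.
Proof.
move=> dq.
have d0 : (0 < d)%N by apply: dvdn_gt0 dq; exact: ltnW.
rewrite -natr_sum -(big_mkord xpredT (fun i => (d %| i)%N : nat)) Zp_cast //.
have -> : (\sum_(0 <= i < q) (d %| i) = q %/ d)%N.
  rewrite divn_count_dvd.
  (* [divn_count_dvd] counts over 1..q, the goal over 0..q-1; both miss one endpoint of 0..q, and
     both endpoints are multiples of [d]. *)
  have := erefl (\sum_(0 <= i < q.+1) (d %| i))%N.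
  rewrite {1}big_nat_recr //= [RHS]big_nat_recl //= dq dvdn0 => /eqP.
  by rewrite addnC eqn_add2l => /eqP ->; rewrite big_add1.
by rewrite -{2}(divnK dq) natrM mulfK // pnatr_eq0 -lt0n.
Qed.

Lemma sumr_const_Zp (c : R) : \sum_(s : 'Z_q) c = q%:R * c.
Proof. by rewrite sumr_const card_ord Zp_cast // mulr_natl. Qed.

Lemma sum_congr_class d s : (d %| q)%N -> \sum_x congr_class d s x = q%:R / d%:R.
Proof.
move=> dq; rewrite -sum_dvdn_Zp // [RHS](reindex (fun x => x - s)) //.
by exists (fun x => x + s) => x _; rewrite ?subrK ?addrK.
Qed.

Lemma congr_class_trans d s t x : (d %| q)%N ->
  congr_class d s t * congr_class d s x = congr_class d s t * congr_class d t x.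
Proof.
move=> dq; rewrite /congr_class; case: (boolP (_ %| (t - s)%R)%N) => [h|_].
  by rewrite -(dvdn_ZpD (x - t) dq h) [t - s + _]addrC addrA subrK.
by rewrite !mul0r.
Qed.

Lemma congr_class_lcm d1 d2 s x :
  congr_class d1 s x * congr_class d2 s x = congr_class (lcmn d1 d2) s x.
Proof. by rewrite /congr_class dvdn_lcm -natrM mulnb. Qed.

(** If [t] lies in both classes, each can be recentred at [t]; otherwise both sides are zero. *)
Lemma congr_class_lcm2 d1 d2 s1 s2 t x : (d1 %| q)%N -> (d2 %| q)%N ->
  congr_class d1 s1 t * congr_class d2 s2 t * (congr_class d1 s1 x * congr_class d2 s2 x)
  = congr_class d1 s1 t * congr_class d2 s2 t * congr_class (lcmn d1 d2) t x.
Proof.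
by move=> h1 h2; rewrite mulrACA !congr_class_trans // mulrACA congr_class_lcm.
Qed.

Lemma chinese_gcd d1 d2 (a b : 'Z_q) : (d1 %| q)%N -> (d2 %| q)%N ->
  (gcdn d1 d2 %| (b - a)%R)%N ->
  exists u : 'Z_q, (d1 %| (u - a)%R)%N && (d2 %| (u - b)%R)%N.
Proof.
move=> h1 h2; have hg : (gcdn d1 d2 %| q)%N by exact: dvdn_trans (dvdn_gcdl _ _) h1.
move=> /(dvdn_ZpP _ hg)[c e].
have d0 : (0 < d1)%N by apply: dvdn_gt0 h1; exact: ltnW.
have [k l ekl _] := egcdnP d2 d0.
have eg : (gcdn d1 d2)%:R = k%:R * d1%:R - l%:R * d2%:R :> 'Z_q.
  by rewrite -!natrM ekl natrD addrAC subrr add0r.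
(* Since [b - a = c * (k * d1 - l * d2)] by Bezout, this witness also equals [b + c * l * d2]. *)
exists (a + c * k%:R * d1%:R); apply/andP; split; apply/dvdn_ZpP => //.
  by exists (c * k%:R); ring.
exists (c * l%:R); move/eqP: e; rewrite subr_eq => /eqP ->; rewrite eg; ring.
Qed.

(** The sum counts common points: two classes meet exactly when their centres agree mod the gcd, and
    then in one class mod the lcm. *)
Lemma sum_congr_classM d1 d2 a b : (d1 %| q)%N -> (d2 %| q)%N ->
  \sum_u congr_class d1 a u * congr_class d2 b u =
  q%:R / (lcmn d1 d2)%:R * congr_class (gcdn d1 d2) a b.
Proof.
move=> h1 h2; have hl : (lcmn d1 d2 %| q)%N by rewrite dvdn_lcm h1.
have hg : (gcdn d1 d2 %| q)%N by exact: dvdn_trans (dvdn_gcdl _ _) h1.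
rewrite [congr_class (gcdn _ _) _ _]/congr_class; case: (boolP (gcdn _ _ %| _)%N) => h.
  have [u /andP[ua ub]] := chinese_gcd h1 h2 h.
  rewrite mulr1 -(sum_congr_class u hl); apply: eq_bigr => x _.
  have := congr_class_lcm2 a b u x h1 h2.
  have -> : congr_class d1 a u = 1 by rewrite /congr_class ua.
  have -> : congr_class d2 b u = 1 by rewrite /congr_class ub.
  by rewrite !mul1r.
rewrite mulr0 big1 // => u _; rewrite /congr_class -natrM mulnb.
case: andP => // -[ua ub]; case/negP: h.
rewrite -(dvdn_ZpD _ hg (dvdn_trans (dvdn_gcdr _ _) ub)) addrA subrK.
exact: dvdn_trans (dvdn_gcdl _ _) ua.
Qed.

End Congruences.

Lemma Dq_dvdn (q : nat) (hq : (1 < q)%N) (d : Dq q) : (val d %| q)%N.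
Proof. by rewrite dvdn_divisors ?(ltnW hq) //; exact: valP. Qed.

(** * Profiles of erasure channels and of their polar transforms *)

Section ErasureProfiles.
Variables (R : realType) (q : nat).
Hypothesis q_gt1 : (1 < q)%N.
Implicit Types (eps : fdist R (Dq q)) (f : ('Z_q -> R) -> R).

Let q_neq0 : q%:R != 0 :> R.
Proof. by rewrite pnatr_eq0 -lt0n ltnW. Qed.

Let d_neq0 d : (d %| q)%N -> d%:R != 0 :> R.
Proof. by move=> dq; rewrite pnatr_eq0 -lt0n (dvdn_gt0 _ dq) // ltnW. Qed.

(* [sum_(r < d) f (indicator of the class of r)], averaged over 'Z_q so that
   changes of variables become translations and unit multiplications of 'Z_q. *)
Definition class_sum f (d : nat) : R :=
  d%:R / q%:R * \sum_(s : 'Z_q) f (congr_class R d s).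

(** Each residue mod [d] has [q / d] representatives in ['Z_q], which the factor [d / q]
    compensates. *)
Lemma class_sum_residues f d : (d %| q)%N ->
  \sum_(r < d) f (fun x => (r == x %% d :> nat)%N%:R) = class_sum f d.
Proof.
move=> dq; have d0 : (0 < d)%N by apply: dvdn_gt0 dq; exact: ltnW.
have dle : (d <= q)%N by apply: dvdn_leq => //; exact: ltnW.
have classE s : congr_class R d s = fun x : 'Z_q => (s %% d == x %% d)%N%:R.
  by apply/funext => x; rewrite congr_class_modn.
rewrite /class_sum (partition_big (fun s : 'Z_q => Ordinal (ltn_pmod s d0)) xpredT) //=.
rewrite mulr_sumr; apply: eq_bigr => r _.
have rE : ((r%:R : 'Z_q) %% d = r)%N.
  by rewrite val_Zp_nat // !modn_small // (leq_trans (ltn_ord r)).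
rewrite (eq_bigr (fun=> f (fun x => (r == x %% d :> nat)%N%:R))); last first.
  by move=> s /eqP <-; rewrite classE.
rewrite big_mkcond /= (eq_bigr (fun s : 'Z_q => congr_class R d r%:R s *
  f (fun x => (r == x %% d :> nat)%N%:R))); last first.
  move=> s _; rewrite congr_class_modn // rE -val_eqE /= eq_sym.
  by case: eqP; rewrite ?mul1r ?mul0r.
rewrite -mulr_suml sum_congr_class // mulrA [X in X * _](_ : _ = 1) ?mul1r //.
by field; rewrite q_neq0 d_neq0.
Qed.

(** The likelihood vector at a class mod [d] is [eps d] times its indicator, and homogeneity
    extracts [eps d]. *)
Lemma profile_erasure eps f : homogeneous f ->
  profile f (erasure_channel eps) = \sum_(d : Dq q) eps d * class_sum f (val d).
Proof.
move=> hf; rewrite /profile.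
transitivity (\sum_(d : Dq q) \sum_(r : 'I_(val d)) f (fun x =>
    erasure_prob eps x (Tagged (fun d : Dq q => 'I_(val d)) r))).
  by rewrite sig_big_dep; apply: eq_bigr => -[].
apply: eq_bigr => d _; rewrite -class_sum_residues ?Dq_dvdn // mulr_sumr.
apply: eq_bigr => r _; rewrite -hf ?fdist_ge0 //; congr f; apply/funext => x.
by rewrite /erasure_prob /=; case: eqP; rewrite ?mulr1 ?mulr0.
Qed.

Lemma profile_erasure2 eps (F : ('Z_q -> R) -> ('Z_q -> R) -> R) :
  (forall v, homogeneous (F v)) -> (forall w, homogeneous (F^~ w)) ->
  profile (fun v => profile (F v) (erasure_channel eps)) (erasure_channel eps) =
  \sum_(p : Dq q * Dq q) eps p.1 * eps p.2 *
    class_sum (fun v => class_sum (F v) (val p.2)) (val p.1).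
Proof.
move=> hr hl; rewrite profile_erasure; last exact: homogeneous_sum.
rewrite -(pair_bigA _ (fun a b : Dq q => eps a * eps b *
  class_sum (fun v => class_sum (F v) (val b)) (val a))) /=.
apply: eq_bigr => d1 _.
under [RHS]eq_bigr => d2 _ do rewrite -mulrA.
rewrite -mulr_sumr; congr (_ * _); rewrite /class_sum.
under eq_bigr => s _ do rewrite profile_erasure //.
rewrite exchange_big mulr_sumr; apply: eq_bigr => d2 _.
by rewrite -mulr_sumr mulrCA.
Qed.

Lemma profile_erasure_comb eps f op
    (hop : forall d1 d2 : Dq q, op (val d1) (val d2) \in divisors q) :
  homogeneous f ->
  profile f (erasure_channel (Fdist (eps_comb_ge0 op eps) (eps_comb_sum1 eps hop))) =
  \sum_(p : Dq q * Dq q) eps p.1 * eps p.2 * class_sum f (op (val p.1) (val p.2)).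
Proof.
move=> hf; rewrite profile_erasure // [RHS](partition_big
  (fun p => SeqSub (hop p.1 p.2)) xpredT) //=.
apply: eq_bigr => d _; rewrite mulr_suml; by apply: eq_big => [p|p /eqP <-].
Qed.

(** The first factor says that [u] is [gamma^-1 * (s1 - x)] mod [d1], so the sum counts common
    points of two classes; multiplying their compatibility condition by [gamma] gives a condition on
    [x]. *)
Lemma minus_kernel gamma d1 d2 (s1 s2 x : 'Z_q) : gamma \is a GRing.unit ->
  (d1 %| q)%N -> (d2 %| q)%N ->
  \sum_u q%:R^-1 * congr_class R d1 s1 (fgamma gamma x u) * congr_class R d2 s2 u =
  (lcmn d1 d2)%:R^-1 * congr_class R (gcdn d1 d2) (s1 - gamma * s2) x.
Proof.
move=> gu h1 h2.
have hg : (gcdn d1 d2 %| q)%N by exact: dvdn_trans (dvdn_gcdl _ _) h1.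
under eq_bigr => u _.
  rewrite (_ : congr_class R d1 s1 _ = congr_class R d1 (gamma^-1 * (s1 - x)) u).
    rewrite -mulrA; over.
  rewrite /congr_class /fgamma -[in RHS](dvdn_ZpMl q_gt1 _ h1 gu) mulrBr mulVKr //.
  by rewrite opprB addrCA addrA.
rewrite -mulr_sumr sum_congr_classM // mulrA mulrA mulVf // mul1r.
congr (_ * _); rewrite /congr_class -(dvdn_ZpMl q_gt1 _ hg gu) mulrBr mulVKr //.
by rewrite !opprB addrCA.
Qed.

Lemma class_sum_minus gamma f d1 d2 : gamma \is a GRing.unit -> homogeneous f ->
  (d1 %| q)%N -> (d2 %| q)%N ->
  class_sum (fun v => class_sum (fun w => f (fun x =>
    \sum_u q%:R^-1 * v (fgamma gamma x u) * w u)) d2) d1 =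
  class_sum f (gcdn d1 d2).
Proof.
move=> gu hf h1 h2; rewrite /class_sum -mulr_sumr exchange_big /=.
rewrite (eq_bigr (fun=> (lcmn d1 d2)%:R^-1 *
    \sum_s f (congr_class R (gcdn d1 d2) s))) => [|s2 _]; last first.
  (* For fixed [s2] the centre [s1 - gamma * s2] runs once over ['Z_q], so every [s2] contributes
     equally. *)
  rewrite mulr_sumr [RHS](reindex (fun s => s - gamma * s2)) /=; last first.
    by exists (fun s => s + gamma * s2) => s _; rewrite ?subrK ?addrK.
  apply: eq_bigr => s1 _; rewrite -hf ?invr_ge0 //; congr f.
  by apply/funext => x; rewrite minus_kernel.
rewrite sumr_const_Zp // !mulrA; congr (_ * _).
have hl : (lcmn d1 d2 %| q)%N by rewrite dvdn_lcm h1.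
(* The prefactors match because the lcm times the gcd is [d1 * d2]. *)
have := muln_lcm_gcd d1 d2 => /(congr1 (fun n => n%:R : R)); rewrite !natrM => e.
transitivity (d1%:R * d2%:R / (q%:R * (lcmn d1 d2)%:R) : R).
  by field; rewrite q_neq0 d_neq0.
by rewrite -e; field; rewrite q_neq0 d_neq0.
Qed.

Lemma class_sum_plus gamma f d1 d2 : gamma \is a GRing.unit -> homogeneous f ->
  (d1 %| q)%N -> (d2 %| q)%N ->
  class_sum (fun v => class_sum (fun w => \sum_u1 f (fun x =>
    q%:R^-1 * v (fgamma gamma u1 x) * w x)) d2) d1 =
  class_sum f (lcmn d1 d2).
Proof.
move=> gu hf h1 h2.
have hl : (lcmn d1 d2 %| q)%N by rewrite dvdn_lcm h1.
rewrite /class_sum -mulr_sumr exchange_big /=.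
under eq_bigr => s2 _ do rewrite exchange_big /=.
(* Averaging over the points [t] of the intersection lets the sums over [s1] and [s2] separate once
   [t] is fixed. *)
have key s1 s2 : f (fun x => congr_class R d1 s1 x * congr_class R d2 s2 x) =
    (lcmn d1 d2)%:R / q%:R * \sum_t congr_class R d1 s1 t *
       congr_class R d2 s2 t * f (congr_class R (lcmn d1 d2) t).
  set B := fun x => _.
  (* [B] is the indicator of a class mod the lcm, or is zero, in which case both
     sides vanish. *)
  rewrite (eq_bigr (fun t => B t * f B)) => [|t _]; last first.
    rewrite -/(B t) -!hf ?mulr_ge0 //; congr f; apply/funext => x.
    by rewrite /B congr_class_lcm2.
  rewrite -mulr_suml sum_congr_classM //.
  move: (sum_congr_classM R q_gt1 s1 s2 h1 h2); rewrite [congr_class R (gcdn _ _) _ _]/congr_class.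
  case: (boolP (_ %| _)%N) => _ sumB.
    by rewrite mulr1; field; rewrite q_neq0 d_neq0.
  have -> : B = fun=> 0.
    apply/funext => x; rewrite mulr0 in sumB.
    by apply: (psumr_eq0P _ sumB) => // y _; rewrite mulr_ge0.
  by rewrite homogeneous0 ?mulr0.
(* Substituting [u1 + gamma * s] for [s1] removes both [u1] and [gamma] from the kernel; the [q]
   values of [u1] then cancel [q^-1]. *)
rewrite (eq_bigr (fun s2 => \sum_s1 f (fun x =>
    congr_class R d1 s1 x * congr_class R d2 s2 x))); last first.
  move=> s2 _; rewrite (eq_bigr (fun=> q%:R^-1 * \sum_s1 f (fun x =>
    congr_class R d1 s1 x * congr_class R d2 s2 x))) => [|u1 _].
    by rewrite sumr_const_Zp // mulrA mulfV // mul1r.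
  rewrite mulr_sumr (reindex (fun s => u1 + gamma * s)) /=; last first.
    exists (fun s => gamma^-1 * (s - u1)) => s _.
      by rewrite addrAC subrr add0r mulKr.
    by rewrite mulVKr // addrC subrK.
  apply: eq_bigr => s _; rewrite -hf ?invr_ge0 //; congr f.
  apply/funext => x; rewrite -mulrA; congr (_ * (_ * _)).
  rewrite /congr_class /fgamma -[in RHS](dvdn_ZpMl q_gt1 _ h1 gu) mulrBr.
  by rewrite opprD addrACA subrr add0r.
under eq_bigr => s2 _ do under eq_bigr => s1 _ do rewrite key.
under eq_bigr => s2 _ do rewrite -mulr_sumr exchange_big /=.
rewrite -mulr_sumr exchange_big /=.
(* A given [t] lies in the class of [s1] for [q / d1] values of [s1], and likewise for [s2]; these
   counts cancel the outer prefactors. *)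
rewrite (eq_bigr (fun t => q%:R / d1%:R * (q%:R / d2%:R) *
    f (congr_class R (lcmn d1 d2) t))) => [|t _].
  by rewrite -mulr_sumr; field; rewrite q_neq0 !d_neq0.
under eq_bigr => s2 _ do rewrite -mulr_suml -mulr_suml.
rewrite -mulr_suml -mulr_sumr; congr (_ * _ * _).
  under eq_bigr => s _ do rewrite congr_class_sym //.
  exact: sum_congr_class.
under eq_bigr => s _ do rewrite congr_class_sym //.
exact: sum_congr_class.
Qed.

End ErasureProfiles.

Theorem theorem1 (R : realType) (q : nat) (hq : (1 < q)%N)
    (eps : fdist R (Dq q)) (gamma : 'Z_q) (hgamma : coprime gamma q) :
  equivalent hq gamma (polar_minus hq gamma (erasure_channel eps))
                      (erasure_channel (eps_minus eps)) /\
  equivalent hq gamma (polar_plus hq gamma (erasure_channel eps))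
                      (erasure_channel (eps_plus eps)).
Proof.
have gu : gamma \is a GRing.unit.
  by rewrite -[gamma]natr_Zp unitZpE // coprime_sym.
split; apply: same_profile_equivalent => f hf.
- rewrite profile_minus profile_erasure2 //; last 2 first.
  + by move=> v; exact: (homogeneous_minusr gamma hf).
  + by move=> w; exact: (homogeneous_minusl gamma hf).
  rewrite profile_erasure_comb //; apply: eq_bigr => -[d1 d2] _.
  by rewrite class_sum_minus ?Dq_dvdn.
- rewrite profile_plus profile_erasure2 //; last 2 first.
  + by move=> v; exact: (homogeneous_plusr gamma hf).
  + by move=> w; exact: (homogeneous_plusl gamma hf).
  rewrite profile_erasure_comb //; apply: eq_bigr => -[d1 d2] _.
  by rewrite class_sum_plus ?Dq_dvdn.
Qed.
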